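(* Let $q$ be a prime power, let $1\le k\le n$, let $\mathbb{C}$ be a set of $k$-dimensional subspaces of $\mathbb{F}_q^n$, and let $X$ be a coset in $\mathbb{F}_q^n$ of some subspace in $\mathbb{C}$ (so that the characteristic vector of $X$ is a codeword of the constant weight code obtained from $\mathbb{C}$). Let $Y\subseteq\mathbb{F}_q^n$ be a subset with $|Y|=q^k$ such that the characteristic vectors of $X$ and $Y$ differ in fewer than $\frac{q^k}{2}$ coordinates. Then the error-correction algorithm described in the context, applied to input $Y$, outputs $X$. That is: the set $Z$ computed by the algorithm is well defined and is the subspace in $\mathbb{C}$ of which $X$ is a coset; an element $\beta\in Y$ of the kind required by the algorithm exists; and for every such $\beta$ one has $\beta+Z=X$.
   Context: The constant weight code obtained from a set $\mathbb{C}$ of $k$-dimensional subspaces of $\mathbb{F}_q^n$ consists of the binary characteristic vectors (of length $q^n$, coordinates indexed by $\mathbb{F}_q^n$) of all cosets $\beta+U$, with $U\in\mathbb{C}$ and $\beta\in\mathbb{F}_q^n$. Codewords and received words are identified with $q^k$-subsets of $\mathbb{F}_q^n$; received words are assumed to have weight $q^k$. The number of errors is the number of coordinates in which the transmitted and received binary words differ. Error-correction algorithm on input a $q^k$-subset $Y=\{y_1,\dots,y_{q^k}\}$ of $\mathbb{F}_q^n$: 1. Form the multiset $\mathcal{T}(Y)$ of differences: if $q$ is even, $\mathcal{T}(Y)=\{y_i-y_j : 1\le i<j\le q^k\}$ (so $|\mathcal{T}(Y)|=\binom{q^k}{2}$); if $q$ is odd, $\mathcal{T}(Y)=\{y_i-y_j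 : 1\le i,j\le q^k,\ i\neq j\}$ (so $|\mathcal{T}(Y)|=q^{2k}-q^k$). 2. Let $Z$ be the set consisting of $0$ together with the $q^k-1$ nonzero elements of $\mathbb{F}_q^n$ having the most appearances in $\mathcal{T}(Y)$. ($Z$ is well defined if these $q^k-1$ elements are uniquely determined, i.e. each appears strictly more often than every other nonzero element.) 3. Choose any $\beta\in Y$ such that $y-\beta\in Z$ for at least $\frac{3q^k}{4}$ elements $y\in Y$ (the case $y=\beta$ being counted). 4. Output $\beta+Z=\{\beta+z : z\in Z\}$. *)

(* Defs.v *)
From HB Require Import structures.
From mathcomp Require Import all_boot all_order all_algebra.

Set Implicit Arguments.
Unset Strict Implicit.
Unset Printing Implicit Defensive.

Import GRing.Theory.
Local Open Scope ring_scope.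

Section ConstantWeightDecoding.

Variables (F : finFieldType) (n : nat).
Local Notation V := 'rV[F]_n.
Local Notation q := #|F|.

Definition vset (U : {vspace V}) : {set V} := [set v | v \in U].

Definition translate (b : V) (A : {set V}) : {set V} := [set b + a | a in A].

Definition is_coset (X : {set V}) (U : {vspace V}) : Prop :=
  exists b : V, X = translate b (vset U).

Definition charvec (A : {set V}) : {ffun V -> bool} := [ffun v => v \in A].

Definition hamming_dist (c d : {ffun V -> bool}) : nat :=
  #|[set v | c v != d v]|.

(* The multiset of differences of the labelled family y, as a sequence with
   repetitions.  For even q only the pairs i < j contribute. *)
Definition differences (m : nat) (y : 'I_m -> V) : seq V :=
  [seq y p.1 - y p.2 |
    p : 'I_m * 'I_m <- enum {: 'I_m * 'I_m} &
      if odd q then p.1 != p.2 else (p.1 < p.2)%N].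

(* Z is a possible choice of 0 together with q^k - 1 nonzero vectors of largest
   multiplicity in T; ties, if any, may be broken arbitrarily. *)
Definition most_frequent (k : nat) (T : seq V) (Z : {set V}) : Prop :=
  [/\ 0 \in Z,
      #|Z :\ 0| = (q ^ k - 1)%N &
      forall z w : V, z \in Z :\ 0 -> w \notin Z ->
        (count_mem w T <= count_mem z T)%N].

(* No tie occurs: the chosen nonzero vectors appear strictly more often than
   all the other nonzero ones. *)
Definition well_defined (k : nat) (T : seq V) : Prop :=
  exists2 Z : {set V}, most_frequent k T Z &
    forall z w : V, z \in Z :\ 0 -> w \notin Z ->
      (count_mem w T < count_mem z T)%N.

(* #|{y in Y | y - b in Z}| >= 3 q^k / 4, cleared of its denominator. *)
Definition admissible (k : nat) (Y Z : {set V}) (b : V) : Prop :=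
  b \in Y /\ (3 * q ^ k <= 4 * #|[set y in Y | (y - b)%R \in Z]|)%N.

End ConstantWeightDecoding.

(* Main.v *)
(** Let [N = q^k] and [t = |Y \ X| = |X \ Y|], so that the number of errors is
    [2t] and [4t < N].  The number of ordered pairs of elements of [Y] with
    difference [w] is at least [N - 2t > N/2] when [w] lies in [U], since of
    the [N] such pairs in [X] at most [t] have their first component outside
    [Y] and at most [t] their second; it is at most [2t < N/2] when [w] is not
    in [U], since one of the two components must then be outside [X].  For even [q] the characteristic is 2 and the algorithm counts
    each unordered pair once, which halves all these numbers.  Hence [Z = U],
    and a point [b] of [Y] has at least [N - t] elements of [Y] in [b + U] if
    it is in [X], but at most [t] otherwise. *)
Require Import Defs.
From HB Require Import structures.
From mathcomp Require Import all_boot all_order all_algebra.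
From mathcomp Require Import all_fingroup all_solvable all_field.
From mathcomp Require Import zify.

Set Implicit Arguments.
Unset Strict Implicit.
Unset Printing Implicit Defensive.

Import GRing.Theory.
Local Open Scope ring_scope.

Lemma card_shift (V : finZmodType) (A : {set V}) (w : V) :
  #|[set v | v + w \in A]| = #|A|.
Proof.
have -> : [set v | v + w \in A] = +%R^~ w @^-1: A.
  by apply/setP=> v; rewrite !inE.
apply: on_card_preimset.
by exists (fun v => v - w) => v _; [exact: addrK | exact: subrK].
Qed.

Lemma card_setD_sym (T : finType) (A B : {set T}) :
  #|A| = #|B| -> #|A :\: B| = #|B :\: A|.
Proof. by move=> eqAB; rewrite !cardsD eqAB setIC. Qed.

(** Cauchy's theorem in the additive group gives a nonzero [x] with [x *+ 2 = 0]; cancelling [x]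
    leaves [2 = 0] in [F]. *)
Lemma even_card_pchar2 (F : finFieldType) : ~~ odd #|F| -> 2%N \in [pchar F].
Proof.
rewrite -dvdn2 -cardsT => evenF.
have [x _ ox] := @Cauchy F 2 [set: F]%G isT evenF.
have x0 : (x : F) != 0 by apply: contra_eq_neq ox => ->; rewrite order1.
have : (x : F) *+ 2 = 0 by rewrite -FinRing.zmodXgE -ox expg_order.
by move/eqP; rewrite -mulr_natr mulf_eq0 (negPf x0) inE.
Qed.

Lemma oppr_rV_even_card (F : finFieldType) (n : nat) (v : 'rV[F]_n) :
  ~~ odd #|F| -> - v = v.
Proof.
by move=> /even_card_pchar2 F2; apply/rowP=> i; rewrite mxE oppr_pchar2.
Qed.

Section DifferenceCounts.

Variables (F : finFieldType) (n m : nat) (y : 'I_m -> 'rV[F]_n).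
Hypothesis y_inj : injective y.
Local Notation V := 'rV[F]_n.
Local Notation swap := (fun p : 'I_m * 'I_m => (p.2, p.1)).
Local Notation Y := [set y i | i : 'I_m].

(** Once the difference [w] is fixed, a pair is determined by its second component. *)
Lemma card_ordered_differences (w : V) :
  #|[set p : 'I_m * 'I_m | y p.1 - y p.2 == w]| = #|[set v in Y | v + w \in Y]|.
Proof.
rewrite -(@card_in_imset _ _ (fun p : 'I_m * 'I_m => y p.2)); last first.
  move=> [i j] [i' j']; rewrite !inE /= => /eqP e1 /eqP e2 /y_inj jj'.
  by move: e1; rewrite jj' -e2 => /addIr/y_inj ->.
apply: eq_card => v; rewrite !inE; apply/imsetP/andP.
  case=> -[i j]; rewrite inE /= => /eqP <- ->.
  by rewrite addrC subrK !imset_f.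
case=> /imsetP[j _ ->] /imsetP[i _ e].
by exists (i, j); rewrite // inE /= -e addrC addKr.
Qed.

(** The factor 1 or 2 reconciles the two conventions for [differences], so that both parities of [q]
    reduce to counting ordered pairs. *)
Lemma count_differences (w : V) : w != 0 ->
  ((if odd #|F| then 1 else 2) * count_mem w (differences y) =
   #|[set v in Y | (v + w)%R \in Y]|)%N.
Proof.
move=> w0; rewrite -card_ordered_differences.
have cntE : count_mem w (differences y) =
   #|[set p : 'I_m * 'I_m | (y p.1 - y p.2 == w) &&
     (if odd #|F| then p.1 != p.2 else (p.1 < p.2)%N)]|.
  rewrite count_map count_filter cardE enumT size_filter.
  by apply: eq_count => p; rewrite !inE.
rewrite cntE; case: ifPn => [_|evenF].
  rewrite mul1n; apply: eq_card => -[i j]; rewrite !inE /=.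
  case: eqP => // e; apply/negP => /eqP ij.
  by case/eqP: w0; rewrite -e ij subrr.
set P := [set _ | _]; set D := [set _ | _].
have ltP p : (p \in P) = (p \in D) && (p.1 < p.2)%N by rewrite !inE.
have swapD p : (swap p \in D) = (p \in D).
  by rewrite !inE /= -opprB (oppr_rV_even_card (_ - _) evenF).
have preP p : (p \in swap @^-1: P) = (p \in D) && (p.2 < p.1)%N.
  by rewrite 2!inE /= -swapD inE.
have Dneq p : p \in D -> (p.1 != p.2 :> nat).
  case: p => i j; rewrite inE /= => /eqP e.
  by apply: contra_neq w0 => /val_inj ij; rewrite -e ij subrr.
(* As [- w = w], swapping preserves [D]; as [w] is nonzero, [D] misses the diagonal. Hence [D] is
   [P] together with its mirror image. *)
have -> : D = P :|: swap @^-1: P.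
  apply/setP=> p; rewrite in_setU preP ltP -andb_orr.
  by case: (boolP (p \in D)) => // /Dneq; rewrite neq_ltn.
rewrite cardsU (_ : P :&: _ = set0) ?cards0 ?subn0; last first.
  apply/setP=> p; rewrite in_setI preP ltP in_set0.
  by apply/negP=> /andP[/andP[_ lt1] /andP[_]]; rewrite ltnNge ltnW.
rewrite (on_card_preimset (R := P)) ?mul2n ?addnn //.
by exists swap => -[].
Qed.

End DifferenceCounts.

Section Counts.

Variables (F : finFieldType) (n : nat) (U : {vspace 'rV[F]_n}).
Variables (X Y : {set 'rV[F]_n}) (XU : is_coset X U).
Hypothesis cardXY : #|X| = #|Y|.

(** Any point of a coset can serve as its base point. *)
Lemma mem_coset (x v : 'rV[F]_n) : x \in X -> (v \in X) = (v - x \in U).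
Proof.
case: XU => b ->; rewrite /translate => /imsetP[u]; rewrite inE => uU ->.
apply/imsetP/idP => [[u'] | vU].
  by rewrite inE => u'U ->; rewrite opprD addrACA subrr add0r rpredB.
exists (v - b); last by rewrite addrC subrK.
by rewrite inE -(subrK u (v - b)) rpredD // -addrA -opprD.
Qed.

Lemma hamming_dist_charvec :
  hamming_dist (charvec X) (charvec Y) = (2 * #|Y :\: X|)%N.
Proof.
have -> : hamming_dist (charvec X) (charvec Y) = #|(X :\: Y) :|: (Y :\: X)|.
  by apply: eq_card => v; rewrite !inE !ffunE; do 2!case: (v \in _).
rewrite cardsU (_ : _ :&: _ = set0) ?cards0 ?subn0; last first.
  by apply/setP=> v; rewrite !inE; do 2!case: (v \in _).
by rewrite (card_setD_sym cardXY) addnn mul2n.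
Qed.

Lemma card_diff_in (u : 'rV[F]_n) : u \in U ->
  (#|Y| - 2 * #|Y :\: X| <= #|[set v in Y | (v + u)%R \in Y]|)%N.
Proof.
move=> uU; rewrite leq_subLR -cardXY.
set S := [set v in Y | _]; set S' := [set v | v + u \in X :\: Y].
have sub : X \subset (X :\: Y) :|: S' :|: S.
  apply/subsetP=> v vX.
  have : v + u \in X by rewrite (mem_coset _ vX) addrC addKr.
  by rewrite !inE vX => ->; do 2!case: (_ \in Y).
apply: leq_trans (subset_leq_card sub) _.
apply: leq_trans (leq_card_setU _ _) _; rewrite leq_add2r.
apply: leq_trans (leq_card_setU _ _) _.
by rewrite card_shift (card_setD_sym cardXY) addnn mul2n.
Qed.

Lemma card_diff_out (w : 'rV[F]_n) : w \notin U ->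
  (#|[set v in Y | (v + w)%R \in Y]| <= 2 * #|Y :\: X|)%N.
Proof.
(* The second copy of [#|Y :\: X|] is turned into the number of [v] with [v + w] in [Y :\: X], so
   the two copies cover the two ways a pair can leave [X]. *)
move=> wU; rewrite mul2n -addnn -{2}(card_shift (Y :\: X) w).
apply: leq_trans (leq_card_setU _ _); apply/subset_leq_card/subsetP => v.
rewrite !inE => /andP[-> ->]; rewrite !andbT.
apply: contraR wU; rewrite negb_or !negbK => /andP[/mem_coset-> ].
by rewrite addrC addKr.
Qed.

Lemma card_coset_in (b : 'rV[F]_n) : b \in X ->
  #|[set v in Y | (v - b)%R \in vset U]| = (#|Y| - #|Y :\: X|)%N.
Proof.
move=> bX; rewrite cardsD subKn ?subset_leq_card ?subsetIl //.
by apply: eq_card => v; rewrite !inE -mem_coset.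
Qed.

(** The coset of [U] through [b] is disjoint from [X]. *)
Lemma card_coset_out (b : 'rV[F]_n) : b \notin X ->
  (#|[set v in Y | (v - b)%R \in vset U]| <= #|Y :\: X|)%N.
Proof.
move=> bX; apply/subset_leq_card/subsetP => v; rewrite !inE => /andP[-> vbU].
rewrite andbT; apply: contra bX => vX.
by rewrite (mem_coset _ vX) -opprB rpredN.
Qed.

Lemma translate_coset (b : 'rV[F]_n) : b \in X -> translate b (vset U) = X.
Proof.
move=> bX; apply/setP=> v; rewrite (mem_coset _ bX); apply/imsetP/idP.
  by case=> u; rewrite inE => uU ->; rewrite addrC addKr.
by move=> vU; exists (v - b); rewrite ?inE // addrC subrK.
Qed.

End Counts.

Theorem corollary1 (F : finFieldType) (n k : nat)
    (k_ge1 : (1 <= k)%N) (k_le_n : (k <= n)%N)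
    (C : {pred {vspace 'rV[F]_n}})
    (dimC : forall U : {vspace 'rV[F]_n}, U \in C -> \dim U = k)
    (U : {vspace 'rV[F]_n}) (UC : U \in C)
    (X : {set 'rV[F]_n}) (XU : is_coset X U)
    (Y : {set 'rV[F]_n}) (cardY : #|Y| = (#|F| ^ k)%N)
    (few_errors :
       (2 * hamming_dist (charvec X) (charvec Y) < #|F| ^ k)%N)
    (y : 'I_(#|F| ^ k) -> 'rV[F]_n) (y_inj : injective y)
    (yY : Y = [set y i | i : 'I_(#|F| ^ k)]) :
  well_defined k (differences y) /\
  forall Z : {set 'rV[F]_n}, most_frequent k (differences y) Z ->
    [/\ Z = vset U,
        exists b : 'rV[F]_n, admissible k Y Z b &
        forall b : 'rV[F]_n, admissible k Y Z b -> translate b Z = X].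
Proof.
have dimU := dimC U UC.
have cardU : #|vset U| = (#|F| ^ k)%N by rewrite cardsE card_vspace dimU.
have cardXY : #|X| = #|Y|.
  by case: XU => b ->; rewrite cardY -cardU card_imset //; apply: addrI.
move: few_errors; rewrite (hamming_dist_charvec cardXY) => few.
have U0 : 0 \in vset U by rewrite inE mem0v.
have cardU' : #|vset U :\ 0| = (#|F| ^ k - 1)%N.
  by rewrite cardsDS ?sub1set // cards1 cardU.
have freq z w : z \in vset U :\ 0 -> w \notin vset U ->
    (count_mem w (differences y) < count_mem z (differences y))%N.
  move=> /setD1P[z0]; rewrite !inE => zU wU.
  have w0 : w != 0 by apply: contraNneq wU => ->; apply: mem0v.
  have cntE v : v != 0 -> _ := @count_differences _ _ _ y y_inj v.
  rewrite -yY in cntE.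
  have c_gt0 : (0 < if odd #|F| then 1 else 2)%N by case: odd.
  rewrite -(ltn_pmul2l c_gt0) !cntE //.
  apply: leq_ltn_trans (card_diff_out Y XU wU) _.
  by apply: leq_trans (card_diff_in XU cardXY zU); rewrite cardY; lia.
(* Exchange argument: as [Z] and [U] have equal size, a [z] in [Z] outside [U] comes with a [w] in
   [U] outside [Z]. Both are nonzero, and [w] is strictly more frequent, against the choice of
   [Z]. *)
have ZU Z : most_frequent k (differences y) Z -> Z = vset U.
  case=> Z0 cardZ maxZ; apply/eqP.
  have cardZU : #|Z| = #|vset U|.
    by rewrite (cardsD1 0) Z0 cardZ (cardsD1 0 (vset U)) U0 cardU'.
  rewrite eqEcard cardZU leqnn andbT.
  apply/subsetP => z zZ; apply: contraT => zU.
  have /subsetPn[w wU wZ] : ~~ (vset U \subset Z).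
    apply: contra zU => sUZ.
    by have /eqP-> : vset U == Z by rewrite eqEcard sUZ cardZU leqnn.
  have z0 : z != 0 by apply: contraNneq zU => ->.
  have w0 : w != 0 by apply: contraNneq wZ => ->.
  have := maxZ z w; rewrite in_setD1 z0 zZ wZ => /(_ isT isT).
  by rewrite leqNgt freq // in_setD1 w0.
split.
  by exists (vset U) => //; split=> // z w zU wU; apply/ltnW/freq.
move=> Z /ZU ->; split=> // [|b [bY]].
  (* Any common point of [X] and [Y] is admissible, since [4(q^k - t) >= 3q^k]. *)
  have : (0 < #|Y :&: X|)%N.
    by move: (cardsID X Y) few; rewrite cardY; lia.
  rewrite card_gt0 => /set0Pn[b /setIP[bY bX]].
  by exists b; split=> //; rewrite (card_coset_in Y XU bX) cardY; lia.
(* Outside [X] the count is at most [t < q^k / 4], too small for [b] to be admissible. *)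
case: (boolP (b \in X)) => [/(translate_coset XU)// | /(card_coset_out Y XU)].
lia.
Qed.
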